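(* Let $R$ be a ring, and let $a,b,c,d\in R$ satisfy $$(ac)^2=(db)(ac),\quad (db)^2=(ac)(db),\quad b(ac)a=b(db)a,\quad c(ac)d=c(db)d.$$ Then $ac\in R^{d}$ if and only if $bd\in R^{d}$. In this case, $$(bd)^{d}=b\big((ac)^{d}\big)^2d.$$
   Context: All rings are associative with an identity $1$; $R^{-1}$ is the set of invertible elements of $R$. For $a\in R$, $comm(a)=\{x\in R : xa=ax\}$ and $comm^2(a)=\{x\in R : xy=yx \text{ for all } y\in comm(a)\}$. Set $R^{qnil}=\{a\in R : 1+ax\in R^{-1}\text{ for every }x\in comm(a)\}$. An element $a\in R$ has a g-Drazin (generalized Drazin) inverse if there exists $b\in R$ such that $b=bab$, $b\in comm^2(a)$ and $a-a^2b\in R^{qnil}$. Such $b$ is unique if it exists and is denoted $a^{d}$. $R^{d}$ (with superscript $d$ as a symbol, unrelated to the element $d\in R$) denotes the set of all g-Drazin invertible elements of $R$. *)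

(* Defs.v *)
From HB Require Import structures.
From mathcomp Require Import all_boot all_algebra.
From mathcomp Require Import boolp classical_sets.

Set Implicit Arguments.
Unset Strict Implicit.
Unset Printing Implicit Defensive.

Import GRing.Theory.
Local Open Scope classical_set_scope.
Local Open Scope ring_scope.

(* [pzRingType] is an associative, not necessarily commutative ring with
   identity; the zero ring is allowed.  It carries no decidable unit
   predicate, so two-sided invertibility is spelled out. *)

Definition invertible {R : pzRingType} : set R :=
  [set x | exists y : R, x * y = 1 /\ y * x = 1].

Definition commutant {R : pzRingType} (a : R) : set R :=
  [set x | GRing.comm x a].

Definition bicommutant {R : pzRingType} (a : R) : set R :=
  [set x | forall y, commutant a y -> GRing.comm x y].

Definition qnil {R : pzRingType} : set R :=
  [set a | forall x, commutant a x -> invertible (1 + a * x)].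

Definition is_gDrazin_inverse {R : pzRingType} (a b : R) : Prop :=
  [/\ b = b * a * b, bicommutant a b & qnil (a - a ^+ 2 * b)].

Definition gDrazin_invertible {R : pzRingType} : set R :=
  [set a | exists b, is_gDrazin_inverse a b].

(* The element a^d; it is the junk value 0 when a is not g-Drazin
   invertible. *)
Definition gDrazin {R : pzRingType} (a : R) : R :=
  xget 0 [set b | is_gDrazin_inverse a b].

Lemma gDrazinP {R : pzRingType} (a : R) :
  gDrazin_invertible a -> is_gDrazin_inverse a (gDrazin a).
Proof. by move=> [b ab]; apply: (xgetI 0 ab). Qed.

Lemma gDrazin_inverse_comm {R : pzRingType} (a b : R) :
  is_gDrazin_inverse a b -> a * b = b * a.
Proof. by case=> _ + _ => /(_ a erefl) ->. Qed.

Lemma gDrazin_inverse_absorb {R : pzRingType} (a b b' : R) :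
  is_gDrazin_inverse a b -> is_gDrazin_inverse a b' ->
  (1 - a * b) * (a * b') = 0.
Proof.
move=> hb hb'.
have ab := gDrazin_inverse_comm hb; have ab' := gDrazin_inverse_comm hb'.
have [bab cb qb] := hb; have [bab' cb' _] := hb'.
have bb' : b' * b = b * b' by symmetry; apply: cb; rewrite /commutant /GRing.comm /= ab'.
set g := _ * _.
have pE : a - a ^+ 2 * b = (1 - a * b) * a.
  by rewrite mulrBl mul1r expr2 -!mulrA -ab.
have gE : (a - a ^+ 2 * b) * b' = g by rewrite pE -mulrA.
have cpa : a * (1 - a * b) = (1 - a * b) * a.
  by rewrite mulrBl mulrBr mul1r mulr1 -[a * b * a]mulrA -ab.
have cpb : b' * (1 - a * b) = (1 - a * b) * b'.
  by rewrite mulrBl mulrBr mul1r mulr1 mulrA -ab' -!mulrA bb'.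
have ff : a * b' * (a * b') = a * b' by rewrite -mulrA [b' * _]mulrA -bab'.
have pp : (1 - a * b) * (1 - a * b) = 1 - a * b.
  by rewrite mulrBl mul1r mulrBr mulr1 -mulrA [b * _]mulrA -bab subrr subr0.
have gg : g * g = g.
  have fp : a * b' * (1 - a * b) = (1 - a * b) * (a * b').
    by rewrite -mulrA cpb mulrA cpa -mulrA.
  rewrite /g; move: (a * b') (1 - a * b) ff pp fp => f p ff pp fp.
  by rewrite -mulrA [f * _]mulrA fp -mulrA ff mulrA pp.
have /qb [y [hy _]] : commutant (a - a ^+ 2 * b) (- b').
  by rewrite /commutant /GRing.comm /= mulrN mulNr pE mulrA cpb -!mulrA ab'.
move: hy; rewrite mulrN gE => hy.
by rewrite -[g]mulr1 -hy mulrA mulrBr mulr1 gg subrr mul0r.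
Qed.

Lemma gDrazin_inverse_unique {R : pzRingType} (a b b' : R) :
  is_gDrazin_inverse a b -> is_gDrazin_inverse a b' -> b = b'.
Proof.
move=> hb hb'.
have ab := gDrazin_inverse_comm hb; have ab' := gDrazin_inverse_comm hb'.
have [bab cb _] := hb; have [bab' _ _] := hb'.
have bb' : b * b' = b' * b by apply: cb; rewrite /commutant /GRing.comm /= ab'.
have e1 := gDrazin_inverse_absorb hb hb'.
have e2 := gDrazin_inverse_absorb hb' hb.
move: e1 e2; rewrite !mulrBl !mul1r => /subr0_eq e1 /subr0_eq e2.
have e3 : a * b * (a * b') = a * b' * (a * b).
  by rewrite -!mulrA [b * _]mulrA -ab [b' * (a * b)]mulrA -ab' -!mulrA bb'.
have e : a * b = a * b' by rewrite e2 -e3 -e1.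
by rewrite [LHS]bab -mulrA e mulrA -ab e ab' -bab'.
Qed.

Lemma gDrazin_eq {R : pzRingType} (a b : R) :
  is_gDrazin_inverse a b -> gDrazin a = b.
Proof.
move=> ab; apply: gDrazin_inverse_unique (ab); apply: gDrazinP; by exists b.
Qed.

(* Main.v *)
Require Import Defs.
From mathcomp Require Import all_boot all_algebra.
From mathcomp Require Import classical_sets.

Import GRing.Theory.
Local Open Scope ring_scope.

(** Put p = ac and q = db.  The forward implication only uses qp = p^2,
    q^2 = pq and pqd = p^2 d.  If x commutes with w = bd, then (dxb)p^4 commutes
    with p, hence with h = p^d; this gives the double commutant property of
    b h^2 d.  The same computation with w replaced by n = b(1 - ph)d shows that
    1 - (nx)^6 is, after a cyclic rotation UV -> VU, of the form 1 + (p - p^2 h)Y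
    with Y commuting with p, so n is quasinilpotent.  The hypotheses are
    invariant under (a, c) <-> (d, b), and Cline's formula is the case
    (a, c) = (d, b), which gives the converse. *)

(** Jacobson's lemma: the inverse 1 - u y v is built from the inverse y of 1 + v u. *)
Lemma invertible_1DM {R : pzRingType} (u v : R) :
  invertible (1 + v * u) -> invertible (1 + u * v).
Proof.
case=> y [y1 y2]; exists (1 - u * y * v); split.
- have -> : (1 + u * v) * (1 - u * y * v)
    = 1 + u * v - u * ((1 + v * u) * y) * v.
    by rewrite mulrBr mulr1 !(mulrDl, mulrDr) !mul1r !mulrA.
  by rewrite y1 mulr1 addrK.
- have -> : (1 - u * y * v) * (1 + u * v)
    = 1 + u * v - u * (y * (1 + v * u)) * v.
    by rewrite mulrBl mul1r !(mulrDl, mulrDr) !(mul1r, mulr1) !mulrA.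
  by rewrite y2 mulr1 addrK.
Qed.

Lemma invertible_mul_comm {R : pzRingType} (x y : R) :
  GRing.comm x y -> invertible (x * y) -> invertible x.
Proof.
move=> xy [z [z1 z2]]; exists (y * z); split; first by rewrite mulrA.
have -> : y * z = z * y; last by rewrite -mulrA -xy.
have {1}-> : y = z * y * (x * y).
  by rewrite -mulrA [y * _]mulrA -xy mulrA z2 mul1r.
by rewrite -!mulrA [x * (y * z)]mulrA z1 mulr1.
Qed.

(** Writing 1 as 1^k shows that 1 + m is a factor of 1 - (-m)^k; the cofactor, a sum of powers of
    -m, commutes with it. *)
Lemma invertible_1D_of_exp {R : pzRingType} (m : R) (k : nat) :
  invertible (1 - (- m) ^+ k) -> invertible (1 + m).
Proof.
rewrite -{1}(expr1n R k) subrXX_comm; last exact: commr_sym (commr1 _).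
rewrite opprK; apply: invertible_mul_comm.
apply: commr_sum => i _; rewrite expr1n mul1r.
by apply/commrX/commr_sym/commrD; [exact: commr1 | rewrite /GRing.comm mulrN mulNr].
Qed.

Section Corner.
Context {R : pzRingType} {p b d u : R}.
Hypotheses (qp : d * b * p = p * p) (qq : d * b * (d * b) = p * (d * b)).
Hypotheses (pqd : p * (d * b) * d = p * p * d).
Hypotheses (up : u * p = p * u) (uqu : u * (d * b) * u = u * (d * b)).

Let qpA z : d * (b * (p * z)) = p * (p * z). Proof. by rewrite !mulrA qp. Qed.
Let qqA z : d * (b * (d * (b * z))) = p * (d * (b * z)).
Proof. by move: qq; rewrite !mulrA => ->. Qed.
Let pqdA z : p * (d * (b * (d * z))) = p * (p * (d * z)).
Proof. by move: pqd; rewrite !mulrA => ->. Qed.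
Let upA z : u * (p * z) = p * (u * z). Proof. by rewrite !mulrA up. Qed.
Let uquA z : u * (d * (b * (u * z))) = u * (d * (b * z)).
Proof. by move: uqu; rewrite !mulrA => ->. Qed.

(** Below, [u] is taken to be 1, where b u d = w, and then 1 - p h, where b u d = n. The cube is the
    first power in which [qq] puts a p to the left of q d, so that [pqd] applies. *)
Lemma corner_pow3 : (b * u * d) ^+ 3 = b * p * p * u * d.
Proof.
rewrite !exprS expr0 mulr1 -!mulrA uquA qqA !upA uquA -upA.
by move: (pqdA 1); rewrite !mulr1 => ->; rewrite !upA.
Qed.

Lemma corner_pow4 : (b * u * d) ^+ 4 = b * p * p * p * u * d.
Proof.
rewrite exprSr corner_pow3 -!mulrA uquA -!upA.
by move: (pqdA 1); rewrite !mulr1 => ->; rewrite !upA.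
Qed.

(** Let m = b u d. By [qp], d m^3 = p^3 u d and m^3 b p = b p^4 u, so the two sides are d m^3 x b p
    and d x m^3 b p. *)
Lemma corner_twist {x : R} : GRing.comm (b * u * d) x ->
  p * p * p * u * d * x * b * p = d * x * b * p * p * p * p * u.
Proof.
move=> /commr_sym/(commrX 3); rewrite corner_pow3 => e.
have -> : p * p * p * u * d * x * b * p = d * (b * p * p * u * d * x) * b * p.
  by rewrite -!mulrA !qpA.
by rewrite -e -!mulrA [d * (b * p)]mulrA qp !upA up.
Qed.

(** After [corner_twist] rewrites the left product, this is the same argument with m^4 in place of
    m^3. *)
Lemma corner_comm {x : R} : GRing.comm (b * u * d) x ->
  GRing.comm p (d * x * b * p * p * p * p * u).
Proof.
move=> nx; rewrite /GRing.comm -{1}(corner_twist nx).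
have /(commrX 4) := commr_sym nx; rewrite corner_pow4 => e.
transitivity (d * (b * p * p * p * u * d * x) * b * p).
  by rewrite -!mulrA !qpA.
by rewrite -e -!mulrA [d * (b * p)]mulrA qp !upA up.
Qed.

End Corner.

Section Transfer.
Context {R : pzRingType} {p b d h : R}.
Hypotheses (qp : d * b * p = p * p) (qq : d * b * (d * b) = p * (d * b)).
Hypotheses (pqd : p * (d * b) * d = p * p * d) (ph : is_gDrazin_inverse p h).

Let hp : h * p = p * h. Proof. by rewrite (gDrazin_inverse_comm ph). Qed.
Let hpA z : h * (p * z) = p * (h * z). Proof. by rewrite !mulrA hp. Qed.
Let phhA z : p * (h * (h * z)) = h * z.
Proof. by rewrite -hpA !mulrA; case: ph => <-. Qed.
Let phh : p * (h * h) = h. Proof. by move: (phhA 1); rewrite !mulr1. Qed.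
Let qpA z : d * (b * (p * z)) = p * (p * z). Proof. by rewrite !mulrA qp. Qed.
Let qqA z : d * (b * (d * (b * z))) = p * (d * (b * z)).
Proof. by move: qq; rewrite !mulrA => ->. Qed.
Let pqdA z : p * (d * (b * (d * z))) = p * (p * (d * z)).
Proof. by move: pqd; rewrite !mulrA => ->. Qed.
Let qhA z : d * (b * (h * z)) = p * (h * z).
Proof. by rewrite -{1}phhA qpA phhA. Qed.
Let hqdA z : h * (d * (b * (d * z))) = p * (h * (d * z)).
Proof. by rewrite -{1}phhA -!hpA pqdA !hpA phhA. Qed.
Let nf := (hpA, phhA, qpA, qhA, hqdA).

Let y := b * h ^+ 2 * d.
Let wy : b * d * y = b * h * d.
Proof. by rewrite /y expr2 -!mulrA !nf. Qed.
Let w3 : (b * d) ^+ 3 = b * p * p * d.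
Proof.
rewrite !exprS expr0 mulr1 -!mulrA qqA; congr (b * _).
by move: pqd; rewrite -!mulrA.
Qed.
Let yw : y * (b * d) = b * h * d.
Proof.
rewrite /y expr2 -!mulrA; congr (b * _).
by move: (hqdA 1); rewrite !mulr1 => ->; rewrite !nf.
Qed.

Let wt_y {t} : GRing.comm (b * d) t ->
  exists2 Y, GRing.comm h Y &
    p * p * p * d * t * b * p = Y /\ d * t * b * p * p * p * p = Y.
Proof.
move=> wt; have u1 : 1 * (d * b) * 1 = 1 * (d * b) by rewrite mulr1.
have u2 : 1 * p = p * 1 by rewrite mul1r mulr1.
have wt1 : GRing.comm (b * 1 * d) t by rewrite mulr1.
exists (d * t * b * p * p * p * p); last first.
  by have := corner_twist qp qq pqd u2 u1 wt1; rewrite !mulr1.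
have := corner_comm qp qq pqd u2 u1 wt1; rewrite mulr1 => pY.
by case: ph => _ hcomm _; apply/hcomm/commr_sym.
Qed.

(** The idempotent e = b h d equals both w y and y w, and e y = y = y e. Once t e = e t e = e t is
    known, y t = y t e = y t w y = y w t y = e t y = t y. *)
Lemma transfer_bicommutant : bicommutant (b * d) y.
Proof.
move=> t /commr_sym wt; have [Y hY [Y1 Y2]] := wt_y wt.
rewrite /GRing.comm; set e := b * h * d.
have ye : y * e = y by rewrite /y /e expr2 -!mulrA !nf.
have ee : e * e = e by rewrite /e -!mulrA !nf.
have ey : e * y = y by rewrite /e -yw -mulrA wy.
have hYn k : h ^+ k * Y = Y * h ^+ k by apply/commr_sym/commrX/commr_sym.
have te : e * t * e = t * e.
  have -> : e * t * e = e * (t * e) by rewrite mulrA.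
  (* Here t e = w t y, and h^2 = p^4 h^6 supplies the p^4 of [Y2]. The result starts with b h, so e
     fixes it on the left. *)
  have -> : t * e = b * (h ^+ 6 * Y) * d.
    by rewrite hYn -[e]wy mulrA -wt /y -Y2 !exprS expr0 mulr1 -!mulrA !nf.
  by rewrite /e exprS -!mulrA !nf.
have et : e * t * e = e * t.
  (* The factor w^3 = b p^2 d supplies the p that [Y1] needs after d t b, and h^2 = h^5 p^3 the p^3
     before it. The product ends in b p h d, which e fixes on the right; e t is recovered through e
     = y^3 w^3. *)
  have yt : y * (t * (b * d) ^+ 3) = b * d * t * (b * p * h * d).
    transitivity (b * (h ^+ 5 * Y) * p * d).
      by rewrite w3 -Y1 /y !exprS expr0 mulr1 -!mulrA !nf.
    by rewrite hYn -Y2 !exprS expr0 mulr1 -!mulrA !nf.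
  have yw3 : y ^+ 3 * (b * d) ^+ 3 = e.
    rewrite -exprMn_comm ?yw; last by rewrite /GRing.comm yw wy.
    by rewrite -/e !exprS expr0 mulr1 !ee.
  have -> : e * t = y ^+ 2 * (b * d * t * (b * p * h * d)).
    by rewrite -yt (commrX 3 (commr_sym wt)) [RHS]mulrA -exprSr [RHS]mulrA yw3.
  by rewrite /e -!mulrA !nf.
have ty : t * y = e * (t * y) by rewrite -[in LHS]ey mulrA -te -2!mulrA ey.
have yt : y * t = y * (t * e).
  by rewrite -[in LHS]ye -mulrA -et -mulrA mulrA ye.
transitivity (y * (t * (b * d)) * y); first by rewrite yt -[e]wy !mulrA.
by rewrite -wt (mulrA y) yw ty mulrA.
Qed.

Let u := 1 - p * h.
Let up : u * p = p * u.
Proof. by rewrite /u mulrBl mulrBr mul1r mulr1 -!mulrA hp. Qed.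
Let uph : u * (p * h) = 0.
Proof. by rewrite /u mulrBl mul1r -!mulrA hpA phh subrr. Qed.
(** The difference is u q p h = u p^2 h = p (u p h) = 0. *)
Let uqu : u * (d * b) * u = u * (d * b).
Proof.
rewrite {2}/u mulrBr mulr1 -!mulrA qpA.
by rewrite (mulrA u p) up -mulrA uph mulr0 subr0.
Qed.
Let wE : b * d - (b * d) ^+ 2 * y = b * u * d.
Proof.
rewrite expr2 -mulrA wy /u mulrBr mulrBl mulr1; congr (_ - _).
by rewrite -!mulrA !nf.
Qed.

Lemma transfer_qnil : qnil (b * d - (b * d) ^+ 2 * y).
Proof.
(* An even exponent removes the sign, and 6 = 3 + 3 allows (n x)^6 = n^3 x^6 n^3, with a cube on
   each side. *)
rewrite wE => x /commr_sym nx; apply: (@invertible_1D_of_exp _ _ 6).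
have nX := commrX 6 nx.
rewrite exprNn -signr_odd expr0 mul1r exprMn_comm //.
rewrite -[6%N]/(3 + 3)%N exprD -mulrA.
have -> : (b * u * d) ^+ 3 * x ^+ (3 + 3) = x ^+ (3 + 3) * (b * u * d) ^+ 3.
  by apply/commr_sym/commrX/commr_sym.
have := corner_twist qp qq pqd up uqu nX.
have := corner_comm qp qq pqd up uqu nX.
rewrite (corner_pow3 qq pqd up uqu).
set X := x ^+ _; set Y := d * X * b * p * p * p * p * u => pY Y1.
(* The last n^3 is cut as (b p)(p u d), so that rotation produces (p u) Y with p u = p - p^2 h. *)
have -> : 1 - b * p * p * u * d * (X * (b * p * p * u * d))
  = 1 + (b * p * p * u * d * X * b * p) * - (p * u * d).
  by rewrite mulrN !mulrA.
apply: invertible_1DM; rewrite mulNr.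
have -> : p * u * d * (b * p * p * u * d * X * b * p) = (p - p ^+ 2 * h) * Y.
  have -> : p - p ^+ 2 * h = p * u by rewrite /u mulrBr mulr1 expr2 !mulrA.
  by rewrite -Y1 -!mulrA qpA.
rewrite -mulrN; case: ph => _ hcomm; apply; apply/commr_sym/commrN/commr_sym.
have hY : GRing.comm Y h by apply/commr_sym/hcomm/commr_sym.
have Yp : GRing.comm Y p := commr_sym pY.
by apply: commrB => //; apply: commrM => //; apply: commrX.
Qed.

Lemma transfer_gDrazin : is_gDrazin_inverse (b * d) y.
Proof.
split; [|exact: transfer_bicommutant|exact: transfer_qnil].
by rewrite -[RHS]mulrA wy /y expr2 -!mulrA !nf.
Qed.

End Transfer.

Theorem theorem2p2 (R : pzRingType) (a b c d : R)
  (h1 : (a * c) ^+ 2 = (d * b) * (a * c))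
  (h2 : (d * b) ^+ 2 = (a * c) * (d * b))
  (h3 : b * (a * c) * a = b * (d * b) * a)
  (h4 : c * (a * c) * d = c * (d * b) * d) :
  (gDrazin_invertible (a * c) <-> gDrazin_invertible (b * d)) /\
  (gDrazin_invertible (a * c) ->
     gDrazin (b * d) = b * gDrazin (a * c) ^+ 2 * d).
Proof.
have key : forall h, is_gDrazin_inverse (a * c) h ->
    is_gDrazin_inverse (b * d) (b * h ^+ 2 * d).
  move=> h; apply: transfer_gDrazin; rewrite -?expr2 //.
  by rewrite expr2 -!mulrA; congr (a * _); move: h4; rewrite -!mulrA => ->.
split; last by move=> /gDrazinP/key/gDrazin_eq.
split=> [[h /key ?]|[h hbd]]; first by exists (b * h ^+ 2 * d).
(* The converse goes from bd to db, then ca, then ac. For the first and last moves p = q, and the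
   transfer hypotheses reduce to associativity; the middle one takes p = db, q = ac. *)
have hdb : is_gDrazin_inverse (d * b) (d * h ^+ 2 * b).
  by apply: (transfer_gDrazin _ _ _ hbd); rewrite ?mulrA.
have hca : is_gDrazin_inverse (c * a) (c * (d * h ^+ 2 * b) ^+ 2 * a).
  apply: (transfer_gDrazin _ _ _ hdb); rewrite -?expr2 //.
  by rewrite expr2 -!mulrA; congr (d * _); move: h3; rewrite -!mulrA => ->.
by eexists; apply: (transfer_gDrazin _ _ _ hca); rewrite ?mulrA.
Qed.
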